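(* Let $\mathcal{G}=(\mathcal{V},\mathcal{E})$ be a graph with finite vertex set $\mathcal{V}$, let $r\ge 1$ be an integer and set $n=r|\mathcal{V}|$. Let $H_{\mathrm{net}}:\mathbb{R}^{n}\times\mathbb{R}^{n}\to\mathbb{R}^+$, $(q,p)\mapsto H_{\mathrm{net}}(q,p)$, be a differentiable function (the Hamiltonian energy function of the graph). Consider the graph system whose state $(q(t),p(t))\in\mathbb{R}^{n}\times\mathbb{R}^{n}$, $t\ge 0$, evolves according to $$\dot q(t)=\frac{\partial H_{\mathrm{net}}}{\partial p}(q(t),p(t)),\qquad \dot p(t)=-\frac{\partial H_{\mathrm{net}}}{\partial q}(q(t),p(t)),$$ with initial state $(q(0),p(0))\in\mathbb{R}^{2n}$. Then: (i) the total energy $H_{\mathrm{net}}(q(t),p(t))$ of the system remains constant in $t$ along every solution; (ii) if $H_{\mathrm{net}}$ is bounded on every bounded subset of $\mathbb{R}^{2n}$ and $H_{\mathrm{net}}(q,p)\to\infty$ as $\|(q,p)\|\to\infty$, then the system is BIBO stable.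
   Context: Here $q(t)$ is the concatenation of the $r$-dimensional feature (position) vectors of all $|\mathcal{V}|$ nodes of the graph, and $p(t)$ is the concatenation of their $r$-dimensional momentum vectors. $\mathbb{R}^+$ denotes $[0,\infty)$. The graph is fixed, so $H_{\mathrm{net}}$ is regarded as a function of $(q,p)$. A solution is a differentiable function $(q,p):[0,\infty)\to\mathbb{R}^{2n}$ satisfying the equations for all $t\ge 0$. BIBO (bounded input bounded output) stability: a system with state $\mathbf{z}(t)$, $t\ge 0$, is BIBO stable if for any bounded input (initial state $\mathbf{z}(0)$) there exists a constant $M$ such that the output satisfies $\|\mathbf{z}(t)\|<M$ for all $t\ge 0$. Here $\mathbf{z}(t)=(q(t),p(t))$. *)

(* Defs.v *)
From HB Require Import structures.
From mathcomp Require Import all_boot all_order all_algebra.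
From mathcomp Require Import all_classical all_reals all_analysis.

Set Implicit Arguments.
Unset Strict Implicit.
Unset Printing Implicit Defensive.

Import Order.TTheory GRing.Theory Num.Theory.
Import numFieldNormedType.Exports.

Local Open Scope classical_set_scope.
Local Open Scope ring_scope.

(* A pair (q, p) of row vectors stands for the concatenated vector of R^(2n). *)
Notation phase R n := ('rV[R]_n * 'rV[R]_n)%type.

(* The Euclidean norm of R^(2n).  The library norm `|z| on phase R n is the
   max norm; it is equivalent to this one and only serves as the underlying
   topology in differentiability and in the limits defining derivatives. *)
Definition enorm (R : realType) (n : nat) (z : phase R n) : R :=
  Num.sqrt (\sum_i z.1 0 i ^+ 2 + \sum_i z.2 0 i ^+ 2).

Definition grad_q (R : realType) (n : nat) (H : phase R n -> R) (z : phase R n)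
  : 'rV[R]_n :=
  \row_i 'D_(delta_mx 0 i : 'rV[R]_n, 0 : 'rV[R]_n) H z.

Definition grad_p (R : realType) (n : nat) (H : phase R n -> R) (z : phase R n)
  : 'rV[R]_n :=
  \row_i 'D_(0 : 'rV[R]_n, delta_mx 0 i : 'rV[R]_n) H z.

(* [f], restricted to [0, +oo[, has derivative [v] at [t]: the difference
   quotient only uses increments h with 0 <= t + h, so this is the two-sided
   derivative for t > 0 and the right derivative for t = 0, and the values of
   [f] on negative reals are irrelevant. *)
Definition has_derive_ge0 (R : realType) (n : nat) (f : R -> 'rV[R]_n) (t : R)
    (v : 'rV[R]_n) : Prop :=
  h^-1 *: (f (t + h) - f t) @[h --> within [set h | 0 <= t + h] 0^'] --> v.

Definition hamiltonian_system (R : realType) (n : nat) (H : phase R n -> R)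
  : set (R -> phase R n) :=
  [set z | forall t : R, 0 <= t ->
     has_derive_ge0 (fun s => (z s).1) t (grad_p H (z t)) /\
     has_derive_ge0 (fun s => (z s).2) t (- grad_q H (z t))].

Definition bounded_on_bounded (R : realType) (n : nat) (H : phase R n -> R)
  : Prop :=
  forall A : set (phase R n),
    [bounded enorm z | z in A] -> [bounded H z | z in A].

(* The filter generated by the complements of the closed balls at 0. *)
Definition at_infinity (R : realType) (n : nat) : set_system (phase R n) :=
  filter_from [set: R] (fun K => [set z | K < enorm z]).
Arguments at_infinity : clear implicits.

(* A system is given by its set of trajectories.  The input is the initial
   state z0, a vector of R^(2n) and hence always of finite norm; the bound M may
   depend on z0 but serves all trajectories issued from z0. *)
Definition BIBO_stable (R : realType) (n : nat) (S : set (R -> phase R n))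
  : Prop :=
  forall z0 : phase R n, exists M : R,
    forall z, S z -> z 0 = z0 -> forall t : R, 0 <= t -> enorm (z t) < M.

(* Main.v *)
(* Along a trajectory t > 0, the chain rule gives
   (H o z)' = dH/dq . dH/dp - dH/dp . dH/dq = 0, and H o z is right-continuous
   at 0, so H is conserved by the mean value theorem.  If H is coercive, the
   sublevel set {H <= H(z 0)}, which contains the trajectory, is bounded. *)
Require Import Defs.
From HB Require Import structures.
From mathcomp Require Import all_boot all_order all_algebra.
From mathcomp Require Import all_classical all_reals all_analysis.

Set Implicit Arguments.
Unset Strict Implicit.
Unset Printing Implicit Defensive.

Import Order.TTheory GRing.Theory Num.Theory.
Import numFieldNormedType.Exports.

Local Open Scope classical_set_scope.
Local Open Scope ring_scope.

(** For [t > 0] every small enough [h] satisfies [0 <= t + h], so the restriction to such increments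
    is vacuous near 0 and the limit is the ordinary two-sided one. *)
Lemma has_derive_ge0_is_derive (R : realType) (n : nat) (f : R -> 'rV[R]_n)
    (t : R) (v : 'rV[R]_n) :
  0 < t -> has_derive_ge0 f t v -> is_derive t 1 f v.
Proof.
move=> t0 ft.
have cf : h^-1 *: ((f \o shift t) (h *: 1) - f t) @[h --> 0^'] --> v.
  rewrite [X in X @ _](_ : _ = fun h => h^-1 *: (f (t + h) - f t)); last first.
    by apply/funext => h /=; rewrite (mulr1 h : h%:A = h) (addrC t).
  apply: cvg_trans ft; apply: cvg_app => P wP.
  have nt : \forall h \near 0^', 0 <= t + h.
    apply: nbhs_dnbhs; near=> h; rewrite -lerBlDl sub0r.
    by apply/ltW; near: h; apply: lt_nbhsr; rewrite oppr_lt0.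
  by move: wP nt; apply: (@filterS2 _ (0^' : set_system R)) => h wPh /wPh.
by split; [apply/cvg_ex; exists v | apply/cvg_lim].
Unshelve. all: by end_near. Qed.

(** Writing [f h - f 0] as [h] times the difference quotient, the limit is [0 *: v]. This supplies
    the continuity at the initial time, where no two-sided derivative is available. *)
Lemma has_derive_ge0_cvg_right0 (R : realType) (n : nat) (f : R -> 'rV[R]_n)
    (v : 'rV[R]_n) :
  has_derive_ge0 f 0 v -> f x @[x --> 0^'+] --> f 0.
Proof.
move=> f0.
have cf : h^-1 *: (f h - f 0) @[h --> 0^'+] --> v.
  (* Any [h > 0] is both nonzero and an admissible increment at 0, so [0^'+] refines the filter of
     [has_derive_ge0]. *)
  apply: cvg_trans f0 => P; rewrite /nbhs/= /at_right /within/=.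
  rewrite /dnbhs /within /=; apply: (@filterS _ (nbhs (0 : R))) => h hP h0.
  by have := hP; rewrite add0r; apply; [rewrite gt_eqF | exact: ltW].
apply/subr_cvg0.
have -> : 0 = (0 : R) *: v by rewrite scale0r.
have c0 : h @[h --> 0^'+] --> (0 : R) by exact: cvg_at_right_filter.
apply: cvg_trans (cvgZ c0 cf); apply: near_eq_cvg; near=> h.
by rewrite scalerA divff ?scale1r.
Unshelve. all: by end_near. Qed.

(** By linearity of the differential it suffices to expand [(u, v)] in the canonical basis; on each
    basis vector the differential is a directional derivative, that is, a gradient entry. *)
Lemma diff_gradE (R : realType) (n : nat) (H : phase R n -> R)
    (z : phase R n) (u v : 'rV[R]_n) : differentiable H z ->
  'd H z (u, v) = \sum_i u 0 i * grad_q H z 0 i + \sum_i v 0 i * grad_p H z 0 i.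
Proof.
move=> dH.
have -> : (u, v) = \sum_i u 0 i *: ('e_i : 'rV[R]_n, 0 : 'rV[R]_n)
                   + \sum_i v 0 i *: (0 : 'rV[R]_n, 'e_i : 'rV[R]_n).
  rewrite [RHS]surjective_pairing; congr (_, _).
    rewrite (raddfD fst) !(raddf_sum fst)/= -row_sum_delta.
    by rewrite big1 ?addr0 // => i _; rewrite scaler0.
  rewrite (raddfD snd) !(raddf_sum snd)/= -row_sum_delta.
  by rewrite big1 ?add0r // => i _; rewrite scaler0.
rewrite raddfD/= !raddf_sum/=; congr (_ + _); apply: eq_bigr => i _;
  by rewrite linearZ/= !mxE deriveE.
Qed.

Lemma diff_hamiltonian_field (R : realType) (n : nat) (H : phase R n -> R)
    (z : phase R n) :
  differentiable H z -> 'd H z (grad_p H z, - grad_q H z) = 0.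
Proof.
move=> dH; rewrite diff_gradE // -big_split big1 //= => i _.
by rewrite [X in _ + X * _]mxE mulNr [X in _ - X]mulrC subrr.
Qed.

Lemma hamiltonian_is_derive0 (R : realType) (n : nat) (H : phase R n -> R)
    (z : R -> phase R n) (t : R) :
  (forall x, differentiable H x) -> hamiltonian_system H z -> 0 < t ->
  is_derive t 1 (H \o z) 0.
Proof.
move=> dH Hz t0; have [/(has_derive_ge0_is_derive t0) [dq q'] ] := Hz t (ltW t0).
move=> /(has_derive_ge0_is_derive t0) [dp p'].
(* Exhibits [z] as a pairing of its components, the form to which [differentiable_pair] and
   [diff_pair] apply. *)
have zE : z = (fun s => ((z s).1, (z s).2)) by apply/funext => s; case: (z s).
have {}dq : differentiable (fun s => (z s).1) t := (derivable1_diffP _ _).1 dq.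
have {}dp : differentiable (fun s => (z s).2) t := (derivable1_diffP _ _).1 dp.
have dz : differentiable z t by rewrite zE; exact: differentiable_pair.
have dHz : differentiable (H \o z) t by exact: differentiable_comp.
split; first exact/derivable1_diffP.
have : 'd (fun s => ((z s).1, (z s).2)) t 1
    = (grad_p H (z t), - grad_q H (z t)).
  by rewrite diff_pair //= -q' -p' !deriveE.
rewrite -zE => z'.
by rewrite deriveE // diff_comp //= z' diff_hamiltonian_field.
Qed.

Lemma hamiltonian_conserved (R : realType) (n : nat) (H : phase R n -> R)
    (z : R -> phase R n) (t : R) :
  (forall x, differentiable H x) -> hamiltonian_system H z -> 0 <= t ->
  H (z t) = H (z 0).
Proof.
move=> dH Hz; rewrite le_eqVlt => /predU1P[<-//|t0].
have cHz s : 0 < s -> {for s, continuous (H \o z)}.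
  move=> s0; apply/differentiable_continuous/derivable1_diffP.
  by have [] := hamiltonian_is_derive0 dH Hz s0.
(* The derivative is needed only on the open interval; at 0, right continuity is enough. *)
have [||c _] := @MVT _ (H \o z) (cst 0) 0 t t0.
- by move=> s /[!in_itv]/= /andP[s0 _]; exact: hamiltonian_is_derive0.
- apply/continuous_within_itvP => //; split.
  + by move=> s /[!in_itv]/= /andP[s0 _]; exact: cHz.
  + have [/has_derive_ge0_cvg_right0 q0 /has_derive_ge0_cvg_right0 p0] :=
      Hz 0 (lexx 0).
    apply: continuous_cvg; first exact: differentiable_continuous.
    have -> : z = (fun s => ((z s).1, (z s).2)).
      by apply/funext => s; case: (z s).
    exact: (cvg_pair q0 p0).
  + exact/cvg_at_left_filter/cHz.
- by rewrite mul0r => /subr0_eq.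
Qed.

(** Lets the limit lemmas for filters, such as [cvgryPgt], apply to limits at infinity. Two ball
    complements meet in the one of larger radius. *)
Instance at_infinity_filter (R : realType) (n : nat) :
  Filter (at_infinity R n).
Proof.
apply: filter_from_filter; first by exists 0.
move=> K L _ _; exists (Num.max K L) => // z /=.
by rewrite gt_max => /andP[].
Qed.

Theorem theorem2 (R : realType) (V : finType) (E : rel V)
    (r : nat) (r_ge1 : (1 <= r)%N)
    (H : phase R (r * #|V|)%N -> R)
    (H_ge0 : forall z : phase R (r * #|V|)%N, 0 <= H z)
    (H_diff : forall z : phase R (r * #|V|)%N, differentiable H z) :
  (forall z : R -> phase R (r * #|V|)%N, hamiltonian_system H z ->
     forall t : R, 0 <= t -> H (z t) = H (z 0)) /\
  (bounded_on_bounded H -> H @ at_infinity R (r * #|V|)%N --> +oo ->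
     BIBO_stable (hamiltonian_system H)).
Proof.
split=> [z Hz t t0|_ Hoo z0]; first exact: (hamiltonian_conserved H_diff Hz t0).
(* Coercivity at the level [H z0]: outside the ball of radius [K] the energy exceeds its initial
   value. This [K] depends on [z0] only, hence serves every trajectory. *)
have /cvgryPgt /(_ (H z0)) [K _ HK] := Hoo.
(* Conservation confines the trajectory to the closed ball of radius [K]; adding 1 makes the bound
   strict. *)
exists (K + 1) => z Hz z0E t t0; apply: (@le_lt_trans _ _ K); last first.
  by rewrite ltrDl.
rewrite leNgt; apply/negP => /HK /=.
by rewrite (hamiltonian_conserved H_diff Hz t0) z0E ltxx.
Qed.
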